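(* For every integer $n \geq 1$, \[ p(n) = \frac{1}{2}\left(1 + n + \sum_{\langle a_1,\dots,a_k\rangle \in \mathcal{A}(n)\setminus\{\langle n\rangle\}} \left\lfloor \frac{a_{k-1}+a_k}{a_{k-1}+1}\right\rfloor\right). \]
   Context: $p(n)$ denotes the number of partitions of $n$. An ascending composition of a positive integer $n$ is a sequence of positive integers $\langle a_1,\dots,a_k\rangle$ with $a_1+\dots+a_k=n$ and $a_1\le a_2\le\dots\le a_k$. $\mathcal{A}(n)$ is the set of all ascending compositions of $n$, and $\langle n\rangle$ is the one-part composition. Every element of $\mathcal{A}(n)\setminus\{\langle n\rangle\}$ has $k\ge 2$ parts, so $a_{k-1}$ is defined. *)

(* Defs.v *)
From HB Require Import structures.
From mathcomp Require Import all_boot all_order all_algebra.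
From mathcomp Require Import finmap multiset.

Set Implicit Arguments.
Unset Strict Implicit.
Unset Printing Implicit Defensive.

Local Open Scope nat_scope.
Local Open Scope fset_scope.
Local Open Scope mset_scope.

(* The ambient finite type only serves to make the comprehension finite: the
   bounds on the length and on the parts are no restriction on finite sequences
   of positive integers with sum n, see [mem_compositions]. *)
Definition compositions (n : nat) : {fset seq nat} :=
  [fset s in [seq map val (t : seq 'I_n.+1) | t : n.-bseq 'I_n.+1]
     | (0 \notin s) && (sumn s == n)].

Definition ascending_compositions (n : nat) : {fset seq nat} :=
  [fset s in compositions n | sorted leq s].

(* Partitions are multisets of positive integers, see [mem_partitions]. *)
Definition partitions (n : nat) : {fset {mset nat}} :=
  [fset seq_mset s | s in compositions n].

Definition npartitions (n : nat) : nat := #|` partitions n|.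

(* For s = <a_1, ..., a_k> with k >= 2, these are a_k and a_(k-1). *)
Definition last_part (s : seq nat) : nat := nth 0 s (size s).-1.
Definition penultimate_part (s : seq nat) : nat := nth 0 s (size s).-2.

Lemma mem_compositions (n : nat) (s : seq nat) :
  (s \in compositions n) = (0 \notin s) && (sumn s == n).
Proof.
rewrite !inE /=; case: (boolP ((0 \notin s) && _)) => [/andP[s0 /eqP sn]|_];
  last by rewrite andbF.
have le_part x : x \in s -> x < n.+1.
  rewrite ltnS -sn; elim: s {s0 sn} => //= y s IHs.
  rewrite inE => /predU1P[->|/IHs le_x]; first exact: leq_addr.
  exact: leq_trans le_x (leq_addl _ _).
have le_size : size s <= n.
  rewrite -sn; elim: s s0 {sn le_part} => //= y s IHs.
  rewrite inE negb_or eq_sym -lt0n => /andP[y0 /IHs le_s].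
  by rewrite -add1n leq_add.
have le_size' : size [seq inord x : 'I_n.+1 | x <- s] <= n by rewrite size_map.
rewrite andbT; apply/imageP; exists (Bseq le_size') => //=.
rewrite -map_comp -[LHS]map_id; apply/eq_in_map => x /le_part lt_x /=.
by rewrite inordK.
Qed.

Lemma mem_ascending_compositions (n : nat) (s : seq nat) :
  (s \in ascending_compositions n) =
  [&& 0 \notin s, sumn s == n & sorted leq s].
Proof. by rewrite inE /= inE /= mem_compositions andbA. Qed.

Lemma mem_partitions (n : nat) (M : {mset nat}) :
  (M \in partitions n) = (0 \notin M) && (\sum_(x <- M) x == n).
Proof.
apply/imfsetP/andP => /= [[s]|[M0 /eqP Mn]].
  rewrite mem_compositions => /andP[s0 /eqP sn] ->.
  rewrite (perm_big _ (perm_eq_seq_mset s)) /= -sumnE sn eqxx; split=> //.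
  by apply: contra s0; rewrite -(perm_mem (perm_eq_seq_mset s)).
exists (M : seq nat); last by rewrite seq_mset_id.
by rewrite mem_compositions sumnE Mn eqxx andbT.
Qed.

(* Main.v *)
Require Import Defs.
From mathcomp Require Import all_boot all_order all_algebra.
From mathcomp Require Import finmap multiset.
From mathcomp Require Import zify.

(** Let [A(m, n)] be the ascending compositions of [n] with all parts at least
    [m], and let [mu] be the summand of the theorem.  By induction on [n - m],
    the sum of [mu] over [A(m, n)] without [<n>] is
    [2 #|A(m, n)| - 1 - n %/ m].  If [n < 2m], then [A(m, n)] only contains
    [<n>].  Otherwise [A(m, n)] is the disjoint union of [A(m + 1, n)] and of
    [m :: A(m, n - m)]; prepending [m] preserves [mu] except on [<n - m>], where
    the new value is [n %/ (m + 1)], and this cancels the correction term of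
    [A(m + 1, n)].  The theorem is the case [m = 1]. *)

Local Open Scope fset_scope.
Local Open Scope nat_scope.

Definition last_quotient (s : seq nat) : nat :=
  (penultimate_part s + last_part s) %/ (penultimate_part s).+1.

(* [f] is fuel: the list is [A(m, n)] as soon as [0 < m <= n <= f + m]. *)
Fixpoint asc_from (f m n : nat) : seq (seq nat) :=
  if f is f'.+1 then
    if m.*2 <= n then
      [seq m :: s | s <- asc_from f' m (n - m)] ++ asc_from f' m.+1 n
    else [:: [:: n]]
  else [:: [:: n]].

(** Two parts of size at least [m] would already sum to [m.*2] or more. *)
Lemma all_geq_sumn_lt_double m n s :
  0 < m -> n < m.*2 ->
  [&& all (leq m) s, sumn s == n & 0 < size s] -> s = [:: n].
Proof.
move=> m0 nm; case: s => [|x [|y s]] /=; first by rewrite andbF.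
  by rewrite addn0 !andbT => /andP[_ /eqP->].
by move=> /andP[/and3P[mx my _] /andP[/eqP sn _]]; lia.
Qed.

Lemma mem_asc_from f m n s : 0 < m -> m <= n -> n <= f + m ->
  (s \in asc_from f m n) = [&& all (leq m) s, sumn s == n & sorted leq s].
Proof.
(* This covers both exits of the recursion: exhausted fuel forces [m = n], hence [n < m.*2] as
   well. *)
have base k l t : 0 < k -> k <= l -> l < k.*2 ->
    (t \in [:: [:: l]]) = [&& all (leq k) t, sumn t == l & sorted leq t].
  move=> k0 kl lk; rewrite inE; apply/eqP/idP => [->|/and3P[kt /eqP tl _]].
    by rewrite /= kl addn0 eqxx.
  apply: (all_geq_sumn_lt_double _ _ _ k0 lk); rewrite kt tl eqxx /=.
  by case: t tl {kt} => //= l0; lia.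
elim: f m n s => [|f IHf] m n s m0 mn nf /=.
  by apply: base; lia.
case: ifP => mn2; last by apply: base; lia.
rewrite mem_cat IHf; try lia.
case: s => [|x s] /=.
  rewrite (_ : 0 == n = false) ?orbF; last by lia.
  by apply/mapP => -[].
have -> : (x :: s \in [seq m :: t | t <- asc_from f m (n - m)]) =
          (x == m) && (s \in asc_from f m (n - m)).
  apply/mapP/andP => [[t tA [-> ->]]|[/eqP-> sA]]; first by rewrite eqxx.
  by exists s.
rewrite IHf; try lia.
(* The head [x] is now a lower bound for the tail, so comparing it with [m] selects the half:
   [x = m] the first, [x > m] the second. *)
rewrite !(path_sortedE leq_trans).
case: (ltngtP x m) => [||->] //=; last first.
  rewrite orbF.
  have -> : (sumn s == n - m) = (m + sumn s == n) by apply/eqP/eqP; lia.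
  by case: (all _ s); rewrite ?andbF.
move=> mx; case xs: (all (leq x) s); rewrite /= ?andbF //.
have le_all k : k <= x -> all (leq k) s.
  by move=> kx; apply: sub_all xs => y; exact: leq_trans.
by rewrite !le_all // ltnW.
Qed.

Lemma singleton_asc_from f m n : 0 < m -> m <= n -> n <= f + m ->
  [:: n] \in asc_from f m n.
Proof. by move=> m0 mn nf; rewrite mem_asc_from //= mn addn0 eqxx. Qed.

(** The two halves are disjoint: [m] heads every list of the first and occurs in none of the
    second. *)
Lemma asc_from_uniq f m n : 0 < m -> m <= n -> n <= f + m ->
  uniq (asc_from f m n).
Proof.
elim: f m n => [|f IHf] m n m0 mn nf //=.
case: ifP => // mn2.
rewrite cat_uniq map_inj_uniq ?IHf; try lia; last by move=> s t [].
rewrite andbT /=; apply/hasPn => s.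
rewrite mem_asc_from; try lia.
move=> /andP[ms _]; apply/mapP => -[t _ st].
by move: ms; rewrite st /= ltnn.
Qed.

Lemma last_quotient_cons m s : 1 < size s ->
  last_quotient (m :: s) = last_quotient s.
Proof. by case: s => [|x [|y s]]. Qed.

(** The correction term stands on the left to avoid truncated subtraction. *)
Lemma sum_last_quotient_asc_from f m n : 0 < m -> m <= n -> n <= f + m ->
  \sum_(s <- asc_from f m n | s != [:: n]) last_quotient s + (n %/ m).+1 =
    (size (asc_from f m n)).*2.
Proof.
have base k l : 0 < k -> k <= l -> l < k.*2 ->
    \sum_(s <- [:: [:: l]] | s != [:: l]) last_quotient s + (l %/ k).+1 = 2.
  move=> k0 kl lk; rewrite big_cons big_nil eqxx.
  by rewrite -(subnK kl) divnDr ?dvdnn // divnn k0 divn_small //; lia.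
elim: f m n => [|f IHf] m n m0 mn nf /=.
  by rewrite base //; lia.
case: ifP => mn2; last by rewrite base //; lia.
have mem_t t : t \in asc_from f m (n - m) -> t != [:: n - m] -> 1 < size t.
  rewrite mem_asc_from; try lia.
  case: t => [|x [|y t]] //=; first by move=> /andP[/eqP]; lia.
  by rewrite addn0 => /and3P[_ /eqP-> _]; rewrite eqxx.
rewrite big_cat /= size_cat size_map doubleD.
rewrite -(IHf m (n - m)); try lia.
rewrite -(IHf m.+1 n); try lia.
have -> : \sum_(s <- [seq m :: t | t <- asc_from f m (n - m)] | s != [:: n])
            last_quotient s =
          n %/ m.+1 +
          \sum_(t <- asc_from f m (n - m) | t != [:: n - m]) last_quotient t.
  (* Here [t] is never empty, so the filter is vacuous on this half. *)
  have cons_neq t : t \in asc_from f m (n - m) -> m :: t != [:: n].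
    by case: t => [/mem_t/(_ isT)//|x t _]; apply/eqP.
  rewrite big_map big_seq_cond (eq_bigl (fun t => t \in asc_from f m (n - m)));
    last by move=> t; case: (boolP (t \in _)) => // /cons_neq ->.
  rewrite -big_seq (bigD1_seq [:: n - m]) /=; last 2 first.
  - by apply: singleton_asc_from; lia.
  - by apply: asc_from_uniq; lia.
  (* The last two parts are [m] and [n - m], with sum [n]. *)
  congr (_ + _); first by rewrite /last_quotient /= subnKC.
  rewrite big_seq_cond [RHS]big_seq_cond; apply: eq_bigr => t /andP[tA tn].
  exact/last_quotient_cons/mem_t.
have -> : n %/ m = ((n - m) %/ m).+1.
  by rewrite -{1}(subnK mn) divnDr ?dvdnn // divnn m0 addn1.
lia.
Qed.

Lemma perm_ascending_compositions n : 0 < n ->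
  perm_eq (ascending_compositions n) (asc_from n 1 n).
Proof.
move=> n0; apply: uniq_perm; first exact: fset_uniq.
  by apply: asc_from_uniq; lia.
move=> s; rewrite mem_ascending_compositions mem_asc_from; try lia.
congr (_ && _); elim: s => //= x s <-.
by rewrite inE negb_or eq_sym lt0n.
Qed.

(** Sorting picks exactly one ascending listing of each multiset. *)
Lemma npartitions_ascending n :
  npartitions n = #|` ascending_compositions n|.
Proof.
have inj_seq_mset : {in ascending_compositions n &, injective (@seq_mset nat)}.
  move=> s t; rewrite !mem_ascending_compositions.
  move=> /and3P[_ _ s_sorted] /and3P[_ _ t_sorted] /eq_seq_msetP.
  exact: (sorted_eq leq_trans anti_leq).
rewrite -(card_in_imfset imfset_key inj_seq_mset) /npartitions.
congr #|` _|; apply/fsetP => M.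
apply/imfsetP/imfsetP => /= -[s sn ->]; last first.
  exists s => //; move: sn.
  by rewrite mem_ascending_compositions mem_compositions andbA => /andP[].
exists (sort leq s); last by apply/eq_seq_msetP; rewrite perm_sym perm_sort.
have s_perm : perm_eq (sort leq s) s by rewrite perm_sort.
rewrite mem_ascending_compositions (perm_mem s_perm) (perm_sumn s_perm).
by rewrite (sort_sorted leq_total) andbT -mem_compositions.
Qed.

Import GRing.Theory.
Local Open Scope ring_scope.

Theorem theorem3p13 (n : nat) (hn : (1 <= n)%N) :
  (npartitions n)%:R =
    2^-1 * (1 + n%:R
      + \sum_(s <- (ascending_compositions n `\ [:: n])%fset)
          (((penultimate_part s + last_part s) %/ (penultimate_part s).+1)%N)%:R)
  :> rat.
Proof.
have perm_n := perm_ascending_compositions n hn.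
have := sum_last_quotient_asc_from n 1 n isT hn (leq_addr _ _).
(* At [m = 1] the correction is [n.+1], the term [1 + n] of the formula. *)
rewrite divn1 -(perm_big _ perm_n) -(perm_size perm_n) /=.
rewrite -npartitions_ascending -big_filter.
have -> : \sum_(s <- [seq t <- ascending_compositions n | t != [:: n]])
            last_quotient s =
          \sum_(s <- ascending_compositions n `\ [:: n]) last_quotient s :> nat.
  apply/perm_big/uniq_perm; rewrite ?filter_uniq ?fset_uniq // => s.
  by rewrite mem_filter in_fsetD1.
move=> /(congr1 (fun k => k%:R : rat)).
rewrite natrD natr_sum -natr1 -mul2n natrM => sumE.
apply: (mulfI (_ : 2 != 0 :> rat)) => //; rewrite mulVKf // -sumE.
by rewrite addrC (addrC 1).
Qed.
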